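(* Let $H=(V,E)$ be a non-separable hypergraph with $|V|\ge 2$ and $|E|\ge 2$. Assume in addition that no edge of $H$ has vertex set equal to $V$, and that $H$ has no weak cut edges. Then any two distinct vertices of $H$ lie on a common cycle of $H$, and any two distinct edges of $H$ lie on a common cycle of $H$.
   Context: A hypergraph $H=(V,E)$ consists of a nonempty finite vertex set $V$, a finite edge set $E$, and an incidence function $\psi:E\to 2^V$; edges are identified with their vertex sets (parallel edges allowed). Two distinct vertices are adjacent via $e$ if both lie in $e$; a walk is a sequence $v_0e_1v_1\dots e_kv_k$ with $v_{i-1},v_i$ adjacent via $e_i$; $H$ is connected if any two distinct vertices are joined by a walk. A cycle is a walk $v_0e_1v_1\dots e_kv_k$ with $k\ge2$, $v_0=v_k$, $v_0,\dots,v_{k-1}$ pairwise distinct and $e_1,\dots,e_k$ pairwise distinct; a vertex (edge) lies on the cycle if it is one of the $v_i$ (one of the $e_i$). For an equivalence class $V'$ of ''joined by a walk'', the connected component is $(V',\{f\in E:\emptyset\ne f\subseteq V'\})$; $\omega(H)$ is the number of components. $H-e=(V,E\setminus\{e\})$; $e$ is a cut edge if $\omega(H-e)>\omega(H)$; a cut edge is strong if $\omega(H-e)=\omega(H)+|e|-1$ and weak otherwise. A hypersubgraph is $(V',E')$ with $V'\subseteq V$, $E'\subseteq E$. A vertex $v$ is a separating vertex of $H$ if there are two connected hypersubgraphs $H_1,H_2$, each with at least one edge, with $E(H_1)\cap E(H_2)=\emptyset$, $V=V(H_1)\cup V(H_2)$, $E=E(H_1)\cup E(H_2)$, and $V(H_1)\cap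 V(H_2)=\{v\}$. $H$ is non-separable if it is connected, has no empty edges and no separating vertices. *)

(* Defs.v *)
From mathcomp Require Import all_boot.

Set Implicit Arguments.
Unset Strict Implicit.
Unset Printing Implicit Defensive.

(* [VT] and [ET] are only carriers: the vertices and the edges are the finite
   sets [vset] and [eset], so that hypersubgraphs and edge deletions live in
   the same type.  The values of [inc] outside [eset] are irrelevant.  Edges
   are labels in [ET], so parallel edges are allowed. *)
Record hypergraph (VT ET : finType) := Hypergraph {
  vset : {set VT};
  eset : {set ET};
  inc : ET -> {set VT};
  vset_neq0 : vset != set0;
  inc_sub : forall e, e \in eset -> inc e \subset vset
}.

Section Hypergraph.
Variables VT ET : finType.
Implicit Types (H : hypergraph VT ET) (u v : VT) (e : ET).

Definition adjacent_via H e u v : bool :=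
  [&& e \in eset H, u != v, u \in inc H e & v \in inc H e].

Definition adjacent H u v : bool := [exists e, adjacent_via H e u v].

(* The walk v0 e1 v1 ... ek vk is given by v0 and
   [:: (e1, v1); ...; (ek, vk)]. *)
Fixpoint walk H v0 (p : seq (ET * VT)) : bool :=
  if p is (e, v) :: p' then adjacent_via H e v0 v && walk H v p'
  else v0 \in vset H.

Definition walk_vertices v0 (p : seq (ET * VT)) : seq VT :=
  v0 :: [seq x.2 | x <- p].

Definition walk_edges (p : seq (ET * VT)) : seq ET := [seq x.1 | x <- p].

Definition walk_end v0 (p : seq (ET * VT)) : VT := last v0 [seq x.2 | x <- p].

(* Existence of a walk, as a boolean relation; see [joinedP]. *)
Definition joined H u v : bool := connect (adjacent H) u v.

Lemma joinedP H u v : u \in vset H ->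
  reflect (exists2 p, walk H u p & walk_end u p = v) (joined H u v).
Proof.
move=> uH; apply: (iffP connectP) => [[q]|[p]].
  elim: q u uH => [|w q IHq] u uH /= => [_ ->|]; first by exists [::].
  case/andP=> /existsP[e uew] /IHq wq /wq [|p pP pv].
    by case/and4P: uew => /inc_sub/subsetP eH _ _ /eH.
  by exists ((e, w) :: p) => //=; rewrite uew.
elim: p u {uH} => [|[e w] p IHp] u /=; first by move=> _ <-; exists [::].
case/andP=> uew /IHp pP /pP [q qP ->]; exists (w :: q) => //=.
by rewrite qP andbT; apply/existsP; exists e.
Qed.

Definition connected H : bool :=
  [forall u in vset H, forall v in vset H, (u != v) ==> joined H u v].

Definition component_of H (W : {set VT}) : {set VT} * {set ET} :=
  (W, [set f in eset H | (inc H f != set0) && (inc H f \subset W)]).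

Definition components H : {set {set VT} * {set ET}} :=
  [set component_of H W | W in equivalence_partition (joined H) (vset H)].

Definition omega H : nat := #|components H|.

Lemma inc_sub_del H e f : f \in eset H :\ e -> inc H f \subset vset H.
Proof. by case/setD1P=> _ /inc_sub. Qed.

Definition del_edge H e : hypergraph VT ET :=
  Hypergraph (vset_neq0 H) (@inc_sub_del H e).

Definition cut_edge H e : bool :=
  (e \in eset H) && (omega H < omega (del_edge H e)).

(* The truncated subtraction is exact: [vset H] is nonempty, so omega H >= 1. *)
Definition strong_cut_edge H e : bool :=
  cut_edge H e && (omega (del_edge H e) == omega H + #|inc H e| - 1).

Definition weak_cut_edge H e : bool :=
  cut_edge H e && ~~ strong_cut_edge H e.

Definition hypersubgraph H' H : Prop :=
  [/\ vset H' \subset vset H, eset H' \subset eset H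
    & {in eset H', inc H' =1 inc H}].

Definition separating_vertex H v : Prop :=
  exists H1 H2 : hypergraph VT ET,
    [/\ hypersubgraph H1 H /\ hypersubgraph H2 H,
        connected H1 /\ connected H2,
        eset H1 != set0 /\ eset H2 != set0,
        eset H1 :&: eset H2 = set0 /\ eset H = eset H1 :|: eset H2
      & vset H = vset H1 :|: vset H2 /\ vset H1 :&: vset H2 = [set v]].

Definition non_separable H : Prop :=
  [/\ connected H,
      forall e, e \in eset H -> inc H e != set0
    & forall v, ~ separating_vertex H v].

(* [belast] drops the final vertex vk = v0, leaving v0, ..., v_(k-1). *)
Definition is_cycle H v0 (p : seq (ET * VT)) : Prop :=
  [/\ walk H v0 p, 1 < size p, walk_end v0 p = v0,
      uniq (belast v0 [seq x.2 | x <- p]) & uniq (walk_edges p)].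

End Hypergraph.

(* Main.v *)
(* Cycles of [H] are the cycles of length at least 4 of its bipartite incidence
   graph, so it is enough that this graph has no cut vertex: in such a graph any
   two connected vertices lie on a common cycle.  A cut vertex of the incidence
   graph that is a vertex of [H] would be separating.  One that is an edge [e]
   would be a cut edge of [H], hence a strong one, so that every component of
   [H - e] meets [e] in exactly one vertex; as [e] does not cover [vset H], one
   of these components is nontrivial, and the vertex it shares with [e] would be
   separating. *)
Require Import Defs.
From mathcomp Require Import all_boot.

Set Implicit Arguments.
Unset Strict Implicit.
Unset Printing Implicit Defensive.

(** * Common cycles in graphs without cut vertices *)

Section CommonCycle.
Variables (T : finType) (g : rel T).

(** Deletion of the node [z], encoded by isolating it so that the carrier stays [T]. *)
Definition avoiding (z : T) : rel T := [rel x y | [&& g x y, x != z & y != z]].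

Lemma path_avoiding z x p :
  path (avoiding z) x p -> path g x p && (z \notin p).
Proof.
elim: p x => //= y p IHp x /andP[/and3P[gxy _ yz] /IHp/andP[-> zp]].
by rewrite gxy inE negb_or eq_sym yz.
Qed.

Hypothesis g_sym : symmetric g.

Lemma avoiding_sym z : connect_sym (avoiding z).
Proof.
by apply: sym_connect_sym => x y; rewrite /avoiding /= g_sym [(_ != z) && _]andbC.
Qed.

Lemma rev_cycle_sym v s : cycle g (v :: rev s) = cycle g (v :: s).
Proof.
have <- : cycle (fun x y => g y x) (v :: s) = cycle g (v :: s).
  by apply: eq_cycle => x y; rewrite g_sym.
by rewrite -rev_cycle rev_cons -rot1_cons rot_cycle revK.
Qed.

(* The path [w :: p] leaves the cycle at [v] and returns to it at [x]. *)
Lemma ear_cycle v s1 x s2 w p u :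
  cycle g (v :: s1 ++ x :: s2) -> uniq (v :: s1 ++ x :: s2) ->
  g v w -> path g w (rcons p x) -> uniq (w :: p) ->
  ~~ has (mem (v :: s1 ++ x :: s2)) (w :: p) ->
  u \in x :: s2 ->
  exists c, [/\ cycle g c, uniq c, u \in c & w \in c].
Proof.
(* The ear replaces the arc [s1]; the arc from [x] back to [v] is kept. *)
move=> cC uC gvw wp uwp dis us; exists (v :: (w :: p) ++ x :: s2); split.
- move: cC; rewrite /= gvw !rcons_cat !cat_path /= => /and3P[_ _ ->].
  by rewrite andbT -rcons_path.
- have sub : {subset v :: x :: s2 <= v :: s1 ++ x :: s2}.
    by move=> y; rewrite !in_cons mem_cat in_cons; case/or3P=> ->; rewrite ?orbT.
  rewrite -cat1s uniq_catCA cat_uniq uwp andTb; apply/andP; split.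
    apply: contra dis => /hasP[y yC yp].
    by apply/hasP; exists y => //; apply: sub.
  by move: uC; rewrite -cat1s uniq_catCA cat_uniq => /and3P[].
- by rewrite inE mem_cat us !orbT.
- by rewrite !inE eqxx orbT.
Qed.

Variable A : {set T}.
Hypothesis gA : forall x y, g x y -> x \in A.
Hypothesis conn : forall z a b, z \in A -> a \in A -> b \in A ->
  a != z -> b != z -> connect (avoiding z) a b.

(* Here [:: u; v] counts as a cycle when [g u v].  By induction along a path
   from [u]: a cycle through [u] and a neighbour of [w] is rerouted through [w]
   by an ear starting with [w]. *)
Lemma common_cycle u v : u \in A -> connect g u v -> u != v ->
  exists c, [/\ cycle g c, uniq c, u \in c & v \in c].
Proof.
move=> uA /connectP[p]; elim/last_ind: p v => [|p w IHp] v /=.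
  by move=> _ ->; rewrite eqxx.
rewrite rcons_path last_rcons => /andP[up gw] ->{v} uw.
have [lu|lu] := eqVneq u (last u p).
  rewrite -lu in gw; exists [:: u; w]; split; rewrite ?inE ?eqxx ?orbT //=.
    by rewrite gw g_sym gw.
  by rewrite inE uw.
have [c [cc uc uIc lc]] := IHp _ up erefl lu.
have [wc|wc] := boolP (w \in c); first by exists c.
move: (last u p) gw lu lc => v gvw uv vc.
have [i s ci] := rot_to vc.
have cs : cycle g (v :: s) by rewrite -ci rot_cycle.
have us : uniq (v :: s) by rewrite -ci rot_uniq.
have ic : c =i v :: s by move=> x; rewrite -ci mem_rot.
have wv : w != v by apply: contra wc => /eqP ->.
have wA : w \in A by apply: (@gA w v); rewrite g_sym.
have vA := gA gvw.
(* Since [v] is not a cut vertex, [w] reaches [u] without it. The path meets the cycle at [u] at the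
   latest; cut at its first node [x] on the cycle, it is the ear. *)
have /connectP[q0 /shortenP[q wq uq _] qu] := conn vA wA uA wv uv.
have /andP[{}wq vq] := path_avoiding wq.
have hq : has (mem (v :: s)) q.
  apply/hasP; exists u; last by rewrite /= -ic.
  move: (mem_last w q); rewrite -qu inE => /orP[/eqP wu|//].
  by rewrite wu eqxx in uw.
move: wq uq vq; case/split_find: hq => x q1 q2 xc hq1.
rewrite cat_path -cat_cons cat_uniq mem_cat mem_rcons inE.
move=> /andP[wq1 _] /andP[uq1 _] /norP[/norP[vx _] _].
have xs : x \in s by move: xc; rewrite /= inE eq_sym (negbTE vx).
move: uq1; rewrite -rcons_cons rcons_uniq => /andP[_ uq1].
have dis : ~~ has (mem (v :: s)) (w :: q1).
  by rewrite /= negb_or hq1 andbT -ic.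
have uIs : u \in s by move: uIc; rewrite ic inE (negbTE uv).
case/splitPr: xs cs us uIs dis {ic ci hq1 xc} => s1 s2 cs us uIs dis.
have [uxs|uxs] := boolP (u \in x :: s2).
  exact: (ear_cycle cs us gvw wq1 uq1 dis uxs).
(* Now [u] is in [s1], the arc the ear would replace; traversing the cycle backwards exchanges the
   two arcs. *)
have re : rev (s1 ++ x :: s2) = rev s2 ++ x :: rev s1.
  by rewrite rev_cat rev_cons cat_rcons.
apply: (@ear_cycle v (rev s2) x (rev s1) w q1 u) => //.
- by rewrite -re rev_cycle_sym.
- by rewrite -re /= mem_rev rev_uniq.
- rewrite -re; congr (~~ _): dis; apply: eq_has => y.
  by rewrite /= !inE mem_rev.
- rewrite inE mem_rev; move: uIs uxs; rewrite mem_cat.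
  by case: (u \in s1); rewrite ?orbT //= => ->.
Qed.

End CommonCycle.

(** * Walks and joined vertices *)

Section Hypergraph.
Variables VT ET : finType.
Implicit Types (H : hypergraph VT ET) (u v w : VT) (e f : ET).

Lemma adjacentP H u v :
  reflect (exists e, [/\ e \in eset H, u != v, u \in inc H e & v \in inc H e])
          (adjacent H u v).
Proof. by apply: (iffP existsP) => -[e /and4P]; exists e. Qed.

Lemma joined_sym H : symmetric (joined H).
Proof.
apply: sym_connect_sym => u v; apply: eq_existsb => e.
by rewrite /adjacent_via eq_sym [(u \in _) && _]andbC.
Qed.

Lemma joined_edge H e u v :
  e \in eset H -> u \in inc H e -> v \in inc H e -> joined H u v.
Proof.
move=> eH ue ve; have [->|uv] := eqVneq u v; first exact: connect0.
by apply: connect1; apply/adjacentP; exists e.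
Qed.

Lemma connected_joined H u v :
  connected H -> u \in vset H -> v \in vset H -> joined H u v.
Proof.
move=> /forall_inP cH uH vH; have [->|uv] := eqVneq u v; first exact: connect0.
by move: (cH u uH) => /forall_inP/(_ v vH); rewrite uv.
Qed.

Lemma joined_incident H u v : joined H u v -> u != v ->
  exists2 e, e \in eset H & u \in inc H e.
Proof.
case/connectP=> -[|w p] /=; first by move=> _ ->; rewrite eqxx.
by case/andP=> /adjacentP[e [eH _ ue _]] _ _ _; exists e.
Qed.

(** * Hypersubgraphs spanned by edge sets, and separating vertices *)

Section EdgeSet.
Variables (H : hypergraph VT ET) (v : VT) (F : {set ET}).
Hypotheses (vH : v \in vset H) (FH : F \subset eset H).

(** Adding [v] by hand keeps the set nonempty and puts [v] on both sides of a separation. *)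
Definition edge_set_vertices : {set VT} := v |: \bigcup_(e in F) inc H e.

Lemma edge_set_vertices_neq0 : edge_set_vertices != set0.
Proof. by apply/set0Pn; exists v; rewrite setU11. Qed.

Lemma edge_set_vertices_inc e : e \in F -> inc H e \subset edge_set_vertices.
Proof. by move=> eF; apply/subsetU/orP; right; apply: bigcup_sup. Qed.

Definition edge_set_hypergraph : hypergraph VT ET :=
  Hypergraph edge_set_vertices_neq0 edge_set_vertices_inc.

Lemma edge_set_hypersubgraph : hypersubgraph edge_set_hypergraph H.
Proof.
split=> //=; rewrite subUset sub1set vH; apply/bigcupsP => e eF.
exact/inc_sub/(subsetP FH).
Qed.

Hypothesis meetF : forall e f w, e \in F -> f \in eset H :\: F ->
  w \in inc H e -> w \in inc H f -> w = v.

(* A walk in [H] towards [v] cannot leave [F] before it reaches [v]. *)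
Lemma edge_set_connected : connected H -> connected edge_set_hypergraph.
Proof.
move=> cH; set H' := edge_set_hypergraph.
suff toV w : w \in vset H' -> joined H' w v.
  apply/forall_inP => x xH'; apply/forall_inP => y yH'; apply/implyP => _.
  by apply: (connect_trans (toV x xH')); rewrite [connect _ _ _]joined_sym toV.
move=> wH'; have wH : w \in vset H.
  by case: edge_set_hypersubgraph => /subsetP/(_ w wH').
have /connectP[p] := connected_joined cH wH vH.
elim: p w wH' {wH} => [|w' p IHp] w wH' /=; first by move=> _ ->; apply: connect0.
have [-> _ _|wv] := eqVneq w v; first exact: connect0.
case/andP=> /adjacentP[e [eH ww' we w'e]] w'p lp.
have eF : e \in F.
  apply/negPn/negP => eF; move: wH'; rewrite !inE (negbTE wv) /=.
  case/bigcupP=> f fF wf; case/eqP: wv; apply: (meetF fF _ wf we).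
  by rewrite inE eF.
apply: connect_trans (IHp w' _ w'p lp); first exact: (@joined_edge H' e).
exact: subsetP (edge_set_vertices_inc eF) _ w'e.
Qed.

End EdgeSet.

(** The two sides are spanned by [F] and its complement, whose roles are symmetric. They cover
    [vset H] because connectedness gives every vertex other than [v] an incident edge. *)
Lemma separating_edge_set H v (F : {set ET}) :
  connected H -> v \in vset H -> F \subset eset H ->
  F != set0 -> eset H :\: F != set0 ->
  (forall e f w, e \in F -> f \in eset H :\: F ->
     w \in inc H e -> w \in inc H f -> w = v) ->
  separating_vertex H v.
Proof.
move=> cH vH FH F0 G0 meetF; have GH := subsetDl (eset H) F.
have DDF : eset H :\: (eset H :\: F) = F.
  by rewrite setDDr setDv set0U; apply/setIidPr.
have meetG e f w : e \in eset H :\: F -> f \in eset H :\: (eset H :\: F) ->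
    w \in inc H e -> w \in inc H f -> w = v.
  by rewrite DDF => eG fF we wf; apply: meetF fF eG wf we.
exists (edge_set_hypergraph H v F), (edge_set_hypergraph H v (eset H :\: F)).
split=> /=; [by split; apply: edge_set_hypersubgraph| |by []| |].
- by split; apply: edge_set_connected.
- by rewrite setIDA setIC -setIDA setDv setI0 -{1}(setID (eset H) F) (setIidPr FH).
split; apply/setP => w; last first.
  rewrite !inE; have [->//|wv /=] := eqVneq w v.
  apply/negP => /andP[/bigcupP[e eF we] /bigcupP[f fG wf]].
  by case/eqP: wv; apply: (meetF e f).
rewrite !inE; have [->//|wv /=] := eqVneq w v.
apply/idP/orP => [wH|]; last first.
  by case=> /bigcupP[e eF]; apply: subsetP; apply: inc_sub;
    [apply: (subsetP FH)|apply: (subsetP GH)].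
have [e eH we] := joined_incident (connected_joined cH wH vH) wv.
by have [eF|eF] := boolP (e \in F); [left|right];
   apply/bigcupP; exists e; rewrite // inE eF.
Qed.

(** * Components and deletion of an edge *)

Definition joined_class H u : {set VT} := [set w in vset H | joined H u w].

(** A component determines its class, being a pair with the class as first entry, so counting
    classes suffices. *)
Lemma omegaE H : omega H = #|joined_class H @: vset H|.
Proof. by apply: card_imset => W W' []. Qed.

Lemma joined_class_eq H u v :
  v \in vset H -> joined_class H u = joined_class H v -> joined H u v.
Proof. by move=> vH /setP/(_ v); rewrite !inE vH [joined H v v]connect0. Qed.

Lemma eq_joined_class H u v :
  joined H u v -> joined_class H u = joined_class H v.
Proof.
move=> uv; apply/setP => w; rewrite !inE; congr (_ && _).
exact: (same_connect (@joined_sym H) uv).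
Qed.

Lemma connected_omega H : connected H = (omega H == 1).
Proof.
rewrite omegaE eqn_leq [0 < _]card_gt0 imset_eq0 vset_neq0 andbT.
apply/idP/card_le1_eqP => [cH _ _ /imsetP[u uH ->] /imsetP[v vH ->]|eqH].
  exact/eq_joined_class/connected_joined.
apply/forall_inP => u uH; apply/forall_inP => v vH; apply/implyP => _.
by apply: joined_class_eq => //; apply: eqH; apply: imset_f.
Qed.

(** Follow a walk of [H] from [u] to a vertex of [e]: just before the first use of [e], or at the
    end if there is none, it stands in [e] and has stayed in [H - e]. *)
Lemma joined_del_edge H e u : connected H -> e \in eset H ->
  inc H e != set0 -> u \in vset H ->
  exists2 x, x \in inc H e & joined (del_edge H e) u x.
Proof.
move=> cH eH /set0Pn[y ye] uH.
have yH := subsetP (inc_sub eH) _ ye.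
have /connectP[p] := connected_joined cH uH yH.
elim: p u {uH} => [|w p IHp] u /=.
  by move=> _ <-; exists y; last exact: connect0.
case/andP=> /adjacentP[f [fH uw uf wf]] wp lp.
have [fe|fe] := eqVneq f e; first by exists u; [rewrite -fe|exact: connect0].
have [x xe wx] := IHp w wp lp; exists x => //; apply: connect_trans wx.
by apply: (@joined_edge _ f); rewrite //= !inE fe.
Qed.

(* Every component of [H - e] meets [e]; when [e] is a strong cut edge there
   are as many components as vertices in [e], so each meets [e] exactly once. *)
Lemma strong_cut_edge_inj H e : connected H -> inc H e != set0 ->
  strong_cut_edge H e ->
  {in inc H e &, forall x y, joined (del_edge H e) x y -> x = y}.
Proof.
move=> cH e0 /andP[/andP[eH _] /eqP].
move: (cH); rewrite connected_omega => /eqP ->; rewrite addKn omegaE => card_e.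
set H' := del_edge H e in card_e *.
have img : joined_class H' @: inc H e = joined_class H' @: vset H.
  apply/eqP; rewrite eqEsubset imsetS ?inc_sub //=.
  apply/subsetP => _ /imsetP[u uH ->].
  have [x xe ux] := joined_del_edge cH eH e0 uH.
  by rewrite (eq_joined_class ux) imset_f.
(* With [omega H = 1], strongness says that [H - e] has exactly [#|inc H e|] classes. *)
have /imset_injP inj : #|joined_class H' @: inc H e| == #|inc H e|.
  by rewrite img -card_e.
by move=> x y xe ye xy; apply: inj => //; apply: eq_joined_class.
Qed.

(** Otherwise [e] is a strong cut edge, and a vertex [x] of [e] whose component in [H - e] is
    nontrivial separates that component's edges from all others. *)
Lemma del_edge_connected H e : non_separable H -> e \in eset H ->
  inc H e <> vset H -> ~~ weak_cut_edge H e -> connected (del_edge H e).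
Proof.
move=> [cH ne nsep] eH eV weak; apply/negPn/negP => ncH'.
set H' := del_edge H e in ncH' *.
have cut : cut_edge H e.
  move: cH ncH'; rewrite /cut_edge eH !connected_omega => /eqP ->.
  rewrite neq_ltn; case/orP => //; rewrite ltnS leqn0 omegaE cards_eq0 imset_eq0.
  by rewrite (negbTE (vset_neq0 _)).
have strong : strong_cut_edge H e.
  by move: weak; rewrite /weak_cut_edge cut negbK.
(* A vertex [w] outside [e] makes the component of its representative [x] in [e] nontrivial. *)
have /subsetPn[w wH we] : ~~ (vset H \subset inc H e).
  by apply/negP => sub; apply: eV; apply/eqP; rewrite eqEsubset inc_sub.
have [x xe wx] := joined_del_edge cH eH (ne e eH) wH.
have wnx : w != x by apply: contraNneq we => ->.
pose F := [set f in eset H' | [exists y in inc H f, joined H' y x]].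
apply: (nsep x); apply: (@separating_edge_set H x F) => //.
- exact: subsetP (inc_sub eH) _ xe.
- by apply/subsetP => f; rewrite !inE => /andP[/andP[]].
- have [f fH' wf] := joined_incident wx wnx.
  apply/set0Pn; exists f; rewrite inE fH' /=.
  by apply/existsP; exists w; rewrite wx andbT.
- by apply/set0Pn; exists e; rewrite !inE eqxx eH.
move=> f h z; rewrite inE => /andP[fH' /exists_inP[y yf yx]] hF zf zh.
have zx : joined H' z x by apply: connect_trans yx; apply: (@joined_edge _ f).
(* If [h] is [e], strongness forces [z = x]; any other [h] through [z] would itself belong to
   [F]. *)
move: hF; rewrite inE => /andP[hF hH]; have [he|he] := eqVneq h e.
  by rewrite he in zh; apply: (strong_cut_edge_inj cH (ne e eH) strong).
by case/negP: hF; rewrite !inE he hH; apply/exists_inP; exists z.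
Qed.

(** * The incidence graph has no cut vertex *)

Definition incidence H : rel (VT + ET) := fun a b =>
  match a, b with
  | inl v, inr e | inr e, inl v => (e \in eset H) && (v \in inc H e)
  | _, _ => false
  end.

Definition incidence_nodes H : {set VT + ET} :=
  [set a | match a with inl v => v \in vset H | inr e => e \in eset H end].

Lemma incidence_sym H : symmetric (incidence H).
Proof. by move=> [v|e] [w|f]. Qed.

Lemma incidence_node H a b : incidence H a b -> a \in incidence_nodes H.
Proof.
rewrite inE; case: a b => [v|e] [w|f] //= /andP[eH] //.
exact/subsetP/inc_sub.
Qed.

Lemma joined_incidence H u v : joined H u v -> connect (incidence H) (inl u) (inl v).
Proof.
case/connectP=> p; elim: p u => [|w p IHp] u /=; first by move=> _ ->; apply: connect0.
case/andP=> /adjacentP[e [eH _ ue we]] /IHp wv /wv; apply: connect_trans.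
apply: (connect_trans (y := inr e)); apply: connect1; rewrite /= eH //.
Qed.

(** Walks of the connected [H - e] lift to incidence paths missing [e]; a node that is an edge is
    first moved to one of its vertices. *)
Lemma incidence_avoid_edge H e a b : non_separable H ->
  connected (del_edge H e) ->
  a \in incidence_nodes H -> b \in incidence_nodes H ->
  a != inr e -> b != inr e -> connect (avoiding (incidence H) (inr e)) a b.
Proof.
move=> [cH ne nsep] cH'.
have sub : subrel (incidence (del_edge H e)) (avoiding (incidence H) (inr e)).
  by move=> [v|f] [w|h] //=; rewrite !inE => /andP[/andP[he hH] vh];
     apply/and3P; split=> //=; rewrite ?hH ?vh.
have toV c : c \in incidence_nodes H -> c != inr e ->
    exists2 v, v \in vset H & connect (avoiding (incidence H) (inr e)) c (inl v).
  case: c => [v|f]; rewrite inE => cH0 cne.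
    by exists v; last exact: connect0.
  have /set0Pn[v vf] := ne f cH0; exists v.
    exact: subsetP (inc_sub cH0) _ vf.
  by apply: connect1; apply/and3P; split=> //=; rewrite cH0.
move=> aH bH /(toV a aH)[u uH au] /(toV b bH)[v vH bv].
apply: connect_trans au _; rewrite avoiding_sym; last exact: incidence_sym.
apply: connect_trans bv _; rewrite avoiding_sym; last exact: incidence_sym.
apply: connect_sub (joined_incidence (connected_joined cH' uH vH)) => x y xy.
exact/connect1/sub.
Qed.

(** Both nodes are first moved to edges. If these were not connected off [v], the edges reachable
    from one of them off [v] would meet the remaining edges only in [v], making [v] separating. *)
Lemma incidence_avoid_vertex H v a b : non_separable H -> v \in vset H ->
  a \in incidence_nodes H -> b \in incidence_nodes H ->
  a != inl v -> b != inl v -> connect (avoiding (incidence H) (inl v)) a b.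
Proof.
move=> [cH ne nsep] vH; set r := avoiding _ _.
have rsym : connect_sym r by apply: avoiding_sym; apply: incidence_sym.
have toE c : c \in incidence_nodes H -> c != inl v ->
    exists2 e, e \in eset H & connect r c (inr e).
  case: c => [w|e]; rewrite inE => cH0 cv; last by exists e; last exact: connect0.
  have [e eH we] := joined_incident (connected_joined cH cH0 vH) cv.
  by exists e => //; apply: connect1; apply/and3P; split; rewrite //= eH.
move=> aH bH /(toE a aH)[e eH ae] /(toE b bH)[f fH bf].
apply: connect_trans ae _; rewrite rsym; apply: connect_trans bf _; rewrite rsym.
apply/negPn/negP => nef; pose F := [set h in eset H | connect r (inr e) (inr h)].
apply: (nsep v); apply: (@separating_edge_set H v F) => //.
- by apply/subsetP => h; rewrite inE => /andP[].
- by apply/set0Pn; exists e; rewrite inE eH connect0.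
- by apply/set0Pn; exists f; rewrite !inE fH (negbTE nef).
move=> h k w; rewrite !inE => /andP[hH eh] /andP[nk kH] wh wk.
apply/eqP/negPn/negP => wv; case/negP: nk; rewrite kH; apply: connect_trans eh _.
by apply: (connect_trans (y := inl w)); apply: connect1;
   apply/and3P; split; rewrite //= ?hH ?kH.
Qed.

(** * From cycles of the incidence graph to cycles of the hypergraph *)

(** The start of the walk is left out, so a closed walk lists its base vertex only at its end. *)
Definition incidence_seq (p : seq (ET * VT)) : seq (VT + ET) :=
  flatten [seq [:: inr x.1; inl x.2] | x <- p].

Lemma mem_incidence_seq_edge e p : (inr e \in incidence_seq p) = (e \in walk_edges p).
Proof. by elim: p => //= -[f w] p IHp; rewrite !inE IHp. Qed.

Lemma mem_incidence_seq_vertex v p :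
  (inl v \in incidence_seq p) = (v \in [seq x.2 | x <- p]).
Proof. by elim: p => //= -[f w] p IHp; rewrite !inE IHp. Qed.

Lemma uniq_incidence_seq p : uniq (incidence_seq p) ->
  uniq (walk_edges p) && uniq [seq x.2 | x <- p].
Proof.
elim: p => //= -[f w] p IHp.
rewrite /= !inE mem_incidence_seq_edge mem_incidence_seq_vertex.
by case/and3P=> /= -> -> /IHp.
Qed.

(** Bipartiteness makes edges and vertices alternate; the induction is on size because nodes are
    removed in pairs. *)
Lemma incidence_path H v w s : path (incidence H) (inl v) s ->
  last (inl v) s = inl w -> exists p, s = incidence_seq p.
Proof.
have [n] := ubnP (size s); elim: n s v => // n IHn [|[//|e] [|[u|//] s]] v //=.
  by exists [::].
  move=> sn /and3P[_ _ us] ls; have [|p ->] := IHn s u _ us ls.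
    by rewrite -ltnS ltnW.
  by exists ((e, u) :: p).
by move=> u _; rewrite andbF.
Qed.

(** An incidence path may return at once to the vertex it came from, whereas adjacency requires
    distinct vertices; hence the last hypothesis. *)
Lemma incidence_walk H v p : v \in vset H ->
  path (incidence H) (inl v) (incidence_seq p) ->
  path (fun x y => x != y) v [seq x.2 | x <- p] -> walk H v p.
Proof.
elim: p v => //= -[e w] p IHp v vH /= /and3P[/andP[eH ve] /andP[_ we] wp] /andP[vw].
move=> nwp; rewrite /adjacent_via eH vw ve we /=; apply: IHp => //.
exact: subsetP (inc_sub eH) _ we.
Qed.

Lemma incidence_cycle H v s :
  cycle (incidence H) (inl v :: s) -> uniq (inl v :: s) -> 1 < size s ->
  exists p, is_cycle H v p /\ inl v :: s =i incidence_seq p.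
Proof.
move=> cs us ss; have lp : last (inl v) (rcons s (inl v)) = inl v :> VT + ET.
  by rewrite last_rcons.
have [p ps] := incidence_path cs lp; exists p.
have vH : v \in vset H.
  case: s {us ss lp ps} cs => [|x s]; first by [].
  by move=> /andP[/(@incidence_node H (inl v) x)]; rewrite inE.
have /uniq_incidence_seq/andP[ue uv] : uniq (incidence_seq p).
  by rewrite -ps rcons_uniq.
(* The closed node list has [(size s).+1] entries, two for each step of [p]. *)
have sp : 1 < size p.
  by case: (p) ps ss => [|x [|y q]] //= /(congr1 size);
     rewrite size_rcons //= => -[->].
split; last by move=> x; rewrite -ps mem_rcons.
case/lastP: p ps ue uv sp => // p [e w] ps ue uv sp.
have wv : w = v.
  by move: (congr1 (last (inl v)) ps); rewrite last_rcons /incidence_seq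
     map_rcons flatten_rcons last_cat => -[].
subst w; move: (uv); rewrite !map_rcons /= rcons_uniq => vp.
(* Consecutive vertices differ by uniqueness; the closing step also needs [p] nonempty. *)
have nep : path (fun x y => x != y) v (rcons [seq x.2 | x <- p] v).
  rewrite rcons_path; apply/andP; split.
    by apply: (@pairwise_sorted _ _ (v :: _)); rewrite -uniq_pairwise.
  case/lastP: p {ps ue uv} vp sp => // q [f z].
  by rewrite map_rcons last_rcons mem_rcons inE eq_sym negb_or => /andP[/andP[]].
split=> //.
- by apply: incidence_walk; rewrite ?map_rcons // -ps.
- by rewrite /walk_end map_rcons last_rcons.
- by rewrite map_rcons belast_rcons.
Qed.

Lemma incidence_common_cycle H a b :
  non_separable H ->
  (forall e, e \in eset H -> inc H e <> vset H) ->
  (forall e, ~~ weak_cut_edge H e) ->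
  a \in incidence_nodes H -> connect (incidence H) a b -> a != b ->
  ~~ incidence H a b ->
  exists v p, [/\ is_cycle H v p, a \in incidence_seq p & b \in incidence_seq p].
Proof.
move=> ns full weak aH cab ab nab.
have [|c [cc uc ac bc]] := common_cycle (@incidence_sym H)
    (@incidence_node H) _ aH cab ab.
  move=> [v|e] x y; rewrite inE => zH xH yH; first exact: incidence_avoid_vertex.
  by apply: incidence_avoid_edge => //; apply: del_edge_connected => //; apply: full.
(* A shorter cycle would make [a] and [b] equal or incident. *)
have sc : 2 < size c.
  case: c cc uc ac bc => [|x [|y []]] //=; rewrite !inE.
    by move=> _ _ /eqP ax /eqP bx; rewrite ax bx eqxx in ab.
  rewrite !andbT => /andP[xy yx] _ /orP[]/eqP ax /orP[]/eqP bx; move: ab nab;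
    by rewrite ax bx ?eqxx // ?xy ?yx.
have [v vc] : exists v, inl v \in c.
  case: c cc sc {uc ac bc} => [|[v|e] [|[w|f] s]] //=; try by exists v; rewrite mem_head.
  by exists w; rewrite !inE eqxx orbT.
have [i s ci] := rot_to vc.
have [||| p [pC cp]] := @incidence_cycle H v s.
- by rewrite -ci rot_cycle.
- by rewrite -ci rot_uniq.
- by move: sc; rewrite -(size_rot i) ci.
by exists v, p; rewrite -!cp -ci !mem_rot.
Qed.

End Hypergraph.

Theorem theorem3p45 (VT ET : finType) (H : hypergraph VT ET)
  (Hns : non_separable H)
  (HV : 2 <= #|vset H|) (HE : 2 <= #|eset H|)
  (Hfull : forall e : ET, e \in eset H -> inc H e <> vset H)
  (Hweak : forall e : ET, ~~ weak_cut_edge H e) :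
  (forall u v : VT, u \in vset H -> v \in vset H -> u != v ->
     exists (v0 : VT) (p : seq (ET * VT)),
       [/\ is_cycle H v0 p, u \in walk_vertices v0 p & v \in walk_vertices v0 p]) /\
  (forall e f : ET, e \in eset H -> f \in eset H -> e != f ->
     exists (v0 : VT) (p : seq (ET * VT)),
       [/\ is_cycle H v0 p, e \in walk_edges p & f \in walk_edges p]).
Proof.
have [cH ne _] := Hns; split=> [u v uH vH uv|e f eH fH ef].
  (* Two nodes of the same kind are never incident, so that side condition is trivial here and for
     edges. *)
  have [||||v0 [p [pC up vp]]] :=
      @incidence_common_cycle _ _ H (inl u) (inl v) Hns Hfull Hweak => //.
  - by rewrite inE.
  - exact/joined_incidence/connected_joined.
  exists v0, p; split=> //; rewrite inE -mem_incidence_seq_vertex;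
    by rewrite ?up ?vp orbT.
have /set0Pn[x xe] := ne e eH; have /set0Pn[y yf] := ne f fH.
have [||||v0 [p [pC ep fp]]] :=
    @incidence_common_cycle _ _ H (inr e) (inr f) Hns Hfull Hweak => //.
- by rewrite inE.
- apply: (connect_trans (y := inl x)); first by apply: connect1; rewrite /= eH.
  apply: (connect_trans (y := inl y)); last by apply: connect1; rewrite /= fH.
  apply/joined_incidence/connected_joined => //.
    exact: subsetP (inc_sub eH) _ xe.
  exact: subsetP (inc_sub fH) _ yf.
by exists v0, p; rewrite -!mem_incidence_seq_edge.
Qed.
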